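(* Let $m,n$ be positive integers and let $q,z,u_1,\dots,u_n,v_1,\dots,v_m$ be complex parameters in general position. Then $$F_{n,m}^{trig(z)}(\overline u|\overline v)=\frac{1}{\prod_{1\le i<j\le m}(v_j-v_i)}\det_{1\le i,j\le m}\Bigg(v_j^{i-1}-zq^{m-i}v_j^{i-1}\prod_{\ell=1}^n\frac{v_j-u_\ell}{v_j-qu_\ell}\Bigg)$$ and $$G_{n,m}^{trig(z)}(\overline u|\overline v)=\frac{(z;q)_\infty}{(q^{m-n}z;q)_\infty}\,\frac{1}{\prod_{1\le i<j\le n}(u_j-u_i)}\det_{1\le i,j\le n}\Bigg(u_j^{i-1}-zq^{m-n+i-1}u_j^{i-1}\prod_{\ell=1}^m\frac{v_\ell-u_j}{v_\ell-qu_j}\Bigg).$$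
   Context: The factor $\frac{(z;q)_\infty}{(q^{m-n}z;q)_\infty}$ denotes $\prod_{j=0}^{m-n-1}(1-q^jz)$ if $n<m$, $1$ if $n=m$, and $\frac{1}{\prod_{j=1}^{n-m}(1-q^{-j}z)}$ if $n>m$. Write $[1,\dots,n]=\{1,\dots,n\}$, $|K|$ for the cardinality of a set $K$, $\overline u=\{u_1,\dots,u_n\}$, $\overline v=\{v_1,\dots,v_m\}$; $j\notin K$ means $j$ lies in the complement of $K$ in the index set over which subsets are taken. The trigonometric source functions are $$F_{n,m}^{trig(z)}(\overline u|\overline v)=\sum_{K\subset[1,\dots,m]}(-z)^{|K|}q^{|K|(|K|-1)/2}\prod_{i\in K,\,j\notin K}\frac{v_i-qv_j}{v_i-v_j}\prod_{i\in K,\,1\le k\le n}\frac{v_i-u_k}{v_i-qu_k},$$ $$G_{n,m}^{trig(z)}(\overline u|\overline v)=\frac{(z;q)_\infty}{(q^{m-n}z;q)_\infty}\sum_{K\subset[1,\dots,n]}(-q^{m-n}z)^{|K|}q^{|K|(|K|-1)/2}\prod_{i\in K,\,j\notin K}\frac{qu_i-u_j}{u_i-u_j}\prod_{i\in K,\,1\le k\le m}\frac{v_k-u_i}{v_k-qu_i}.$$ ''In general position'' means $q\neq0$ and that zeros of all factors in denominators are avoided. *)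

(* Defs.v *)
From mathcomp Require Import all_boot all_order all_algebra.
From mathcomp Require Import reals complex.

Set Implicit Arguments.
Unset Strict Implicit.
Unset Printing Implicit Defensive.

Import GRing.Theory.

Local Open Scope ring_scope.

(* Indices are 0-based: the families u_1, ..., u_n and v_1, ..., v_m are
   functions on 'I_n and 'I_m, and the exponents i - 1 become i. *)

(* (z; q)_oo / (q^(m - n) z; q)_oo *)
Definition qpoch_ratio (C : fieldType) (m n : nat) (q z : C) : C :=
  if (n < m)%N then \prod_(0 <= j < m - n) (1 - q ^+ j * z)
  else if n == m then 1
  else (\prod_(1 <= j < (n - m).+1) (1 - q ^- j * z))^-1.

Definition F_trig (C : fieldType) (n m : nat) (q z : C)
    (u : 'I_n -> C) (v : 'I_m -> C) : C :=
  \sum_(K : {set 'I_m})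
    (- z) ^+ #|K| * q ^+ (#|K| * (#|K| - 1) %/ 2)
    * (\prod_(i in K) \prod_(j | j \notin K) ((v i - q * v j) / (v i - v j)))
    * (\prod_(i in K) \prod_(k < n) ((v i - u k) / (v i - q * u k))).

Definition G_trig (C : fieldType) (n m : nat) (q z : C)
    (u : 'I_n -> C) (v : 'I_m -> C) : C :=
  qpoch_ratio m n q z *
  \sum_(K : {set 'I_n})
    (- (q ^ (m%:Z - n%:Z) * z)) ^+ #|K| * q ^+ (#|K| * (#|K| - 1) %/ 2)
    * (\prod_(i in K) \prod_(j | j \notin K) ((q * u i - u j) / (u i - u j)))
    * (\prod_(i in K) \prod_(k < m) ((v k - u i) / (v k - q * u i))).

(* q != 0 and no denominator vanishes. The last clause concerns the
   denominator of [qpoch_ratio]; it is vacuous when n <= m, since n - m is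
   then 0. *)
Definition general_position (C : fieldType) (n m : nat) (q z : C)
    (u : 'I_n -> C) (v : 'I_m -> C) : Prop :=
  [/\ q != 0,
      forall i j : 'I_n, i != j -> u i - u j != 0,
      forall i j : 'I_m, i != j -> v i - v j != 0,
      forall (i : 'I_m) (k : 'I_n), v i - q * u k != 0
    & forall j : nat, (1 <= j <= n - m)%N -> 1 - q ^- j * z != 0].

(* Main.v *)
Require Import Defs.
From mathcomp Require Import all_boot all_order all_algebra.
From mathcomp Require Import reals complex.

Set Implicit Arguments.
Unset Strict Implicit.
Unset Printing Implicit Defensive.

Import GRing.Theory.

Local Open Scope ring_scope.

(** Both identities are one expansion of a determinant.  Column [j] of the
    matrix is the sum of the Vandermonde column of a node [x j] and a multiple
    [w j] of the Vandermonde column of the rescaled node [t * x j]: for [F] take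
    [x = v] and [t = q^-1], since [q ^+ (m - i.+1) = q ^+ m.-1 * q ^- i]; for
    [G] take [x = u] and [t = q].  Expanding by multilinearity in the columns
    gives a sum over the sets [K] of columns in which the rescaled node is
    chosen, and every term is a Vandermonde determinant, hence a product over
    pairs of nodes ([det_vandermonde_perturb]).

    Divide such a product by the Vandermonde product of [x].  A pair outside [K]
    contributes [1], a pair inside [K] contributes [t], which makes
    [t ^+ (k * (k - 1) %/ 2)] with [k] the cardinal of [K], and a pair with
    [i] in [K] and [j] outside contributes [(t * x i - x j) / (x i - x j)],
    whichever of the two indices is larger ([vandermonde_ratio]).  For [G] this
    is the summand as it stands.  For [F], the powers of [q^-1] taken out of
    the mixed factors and the power [q ^+ (m.-1 * k)] combine to
    [q ^+ (k * (k - 1) %/ 2)]. *)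

(** The bridge from Vandermonde products, taken over [i < j], to products over
    [i] in [K] and [j] outside [K], which ignore the order of the indices. *)
Lemma big_ltn_sym (T : Type) (idx : T) (op : Monoid.com_law idx) (n : nat)
    (h : 'I_n -> 'I_n -> T) :
  \big[op/idx]_(i < n) \big[op/idx]_(j < n | (i < j)%N) op (h i j) (h j i) =
  \big[op/idx]_(i < n) \big[op/idx]_(j < n | j != i) h i j.
Proof.
under eq_bigr do rewrite big_split.
rewrite big_split /= [X in op _ X](exchange_big_dep predT) //= -big_split /=.
apply: eq_bigr => i _.
rewrite [RHS](bigID (fun j : 'I_n => (i < j)%N)) /=; congr (op _ _);
  apply: eq_bigl => j; rewrite -val_eqE /=; by case: ltngtP.
Qed.

(** Doubling the count turns unordered pairs into ordered pairs of distinct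
    elements of [K]. *)
Lemma card_ltn_pairs (n : nat) (K : {set 'I_n}) :
  (\sum_(i < n) \sum_(j < n | i < j) ((i \in K) && (j \in K)) =
   (#|K| * (#|K| - 1)) %/ 2)%N.
Proof.
set S := LHS.
suff <- : (S * 2 = #|K| * (#|K| - 1))%N by rewrite mulnK.
have -> : (S * 2 = \sum_(i < n) \sum_(j < n | j != i)
                     ((i \in K) && (j \in K)))%N.
  rewrite -(big_ltn_sym _ (fun i j : 'I_n => ((i \in K) && (j \in K) : nat))).
  rewrite big_distrl; apply: eq_bigr => i _.
  rewrite big_distrl; apply: eq_bigr => j _.
  by rewrite /= [(j \in K) && _]andbC muln2 addnn.
rewrite (bigID (mem K)) /= [X in (_ + X)%N]big1 ?addn0; last first.
  by move=> i iK; apply: big1 => j _; rewrite (negbTE iK).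
rewrite -sum_nat_const; apply: eq_bigr => i iK.
rewrite subn1 (cardsD1 i) iK /= -sum1_card big_mkcond [RHS]big_mkcond /=.
by apply: eq_bigr => j _; rewrite !inE; case: (j == i); case: (j \in K).
Qed.

(** The quotient of the two factors of a pair is symmetric in its indices, so a
    mixed pair can always be written with its element of [K] first. *)
Lemma vandermonde_ratio (C : fieldType) (n : nat) (t : C) (x : 'I_n -> C)
    (K : {set 'I_n}) :
  (forall i j, i != j -> x i - x j != 0) ->
  let y i := (if i \in K then t else 1) * x i in
  (\prod_(i < n) \prod_(j < n | (i < j)%N) (x j - x i))^-1 *
    \prod_(i < n) \prod_(j < n | (i < j)%N) (y j - y i) =
  t ^+ ((#|K| * (#|K| - 1)) %/ 2) *
    \prod_(i in K) \prod_(j | j \notin K) ((t * x i - x j) / (x i - x j)).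
Proof.
move=> x_inj y.
(* [h i j * h j i] is the quotient at a mixed pair, in either order, and 1
   elsewhere, so that [big_ltn_sym] applies *)
pose h i j := if (i \in K) && (j \notin K)
  then (t * x i - x j) / (x i - x j) else 1.
have -> : \prod_(i in K) \prod_(j | j \notin K)
    ((t * x i - x j) / (x i - x j)) = \prod_i \prod_(j | j != i) h i j.
  rewrite big_mkcond; apply: eq_bigr => i _; rewrite /h.
  case: (boolP (i \in K)) => iK /=; last by rewrite big1.
  rewrite big_mkcond [RHS]big_mkcond; apply: eq_bigr => j _.
  by case: eqP => [->|_] /=; rewrite ?iK.
rewrite -big_ltn_sym -card_ltn_pairs mulrC -prodf_div expr_sum -big_split /=.
apply: eq_bigr => i _; rewrite -prodf_div expr_sum -big_split /=.
apply: eq_bigr => j ij; rewrite /h /y.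
have xij : x i - x j != 0 by apply: x_inj; rewrite -val_eqE neq_ltn ij.
have xji : x j - x i != 0 by apply: x_inj; rewrite -val_eqE neq_ltn ij orbT.
case: (boolP (i \in K)) => iK; case: (boolP (j \in K)) => jK /=;
  rewrite ?expr1 ?expr0 ?mul1r ?mulr1 //.
- by rewrite -mulrBr mulfK.
- by rewrite -[LHS]mulrNN -invrN !opprB.
- by rewrite divff.
Qed.

(** Multilinearity in the columns: [K] records the columns taken from [B].  The
    determinant is transposed so that the product in the Leibniz formula runs
    over columns, which makes [K] independent of the permutation. *)
Lemma det_col_add (C : comPzRingType) (n : nat) (A B : 'M[C]_n) :
  \det (A + B) =
  \sum_(K : {set 'I_n}) \det (\matrix_(i, j) if j \in K then B i j else A i j).
Proof.
rewrite -det_tr /determinant.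
under eq_bigr => s _.
  under eq_bigr => i _ do rewrite !mxE addrC.
  rewrite bigA_distr big_distrr; over.
rewrite exchange_big; apply: eq_bigr => K _.
rewrite -[RHS]det_tr /determinant; apply: eq_bigr => s _ /=.
by congr (_ * _); apply: eq_bigr => i _; rewrite !mxE.
Qed.

(** Each term of the column expansion is a Vandermonde matrix with the nodes of
    [K] rescaled, times a diagonal matrix carrying the weights of [K]. *)
Lemma det_vandermonde_perturb (C : fieldType) (n : nat) (t : C)
    (x w : 'I_n -> C) :
  (forall i j, i != j -> x i - x j != 0) ->
  (\prod_(i < n) \prod_(j < n | (i < j)%N) (x j - x i))^-1 *
    \det (\matrix_(i < n, j < n) (x j ^+ i + w j * (t * x j) ^+ i)) =
  \sum_(K : {set 'I_n}) (\prod_(i in K) w i) * t ^+ ((#|K| * (#|K| - 1)) %/ 2) *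
    \prod_(i in K) \prod_(j | j \notin K) ((t * x i - x j) / (x i - x j)).
Proof.
move=> x_inj.
have -> : \matrix_(i < n, j < n) (x j ^+ i + w j * (t * x j) ^+ i) =
    (\matrix_(i, j) x j ^+ i) + \matrix_(i, j) (w j * (t * x j) ^+ i).
  by apply/matrixP => i j; rewrite !mxE.
rewrite det_col_add big_distrr; apply: eq_bigr => K _ /=.
pose y i := (if i \in K then t else 1) * x i.
have -> : \matrix_(i, j) (if j \in K
      then (\matrix_(i, j) (w j * (t * x j) ^+ i)) i j
      else (\matrix_(i, j) x j ^+ i) i j) =
    Vandermonde n (\row_j y j) *m
      diag_mx (\row_j if j \in K then w j else 1).
  apply/matrixP => i j; rewrite mul_mx_diag !mxE /y.
  by case: ifP => _; rewrite ?mulr1 ?mul1r // mulrC.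
rewrite det_mulmx det_diag det_Vandermonde.
under [X in _ * (X * _)]eq_bigr do under eq_bigr do rewrite !mxE.
under [X in _ * (_ * X)]eq_bigr do rewrite mxE.
by rewrite -big_mkcond mulrA vandermonde_ratio //= mulrC mulrA.
Qed.

(** The arithmetic that turns the base [q^-1] of the expansion into the base
    [q] of the source function: [k * (m - k)] mixed pairs and [k * (k - 1) / 2]
    inner ones each carry a [q^-1]. *)
Lemma expf_mixed_pairs (C : fieldType) (q : C) (k m : nat) :
  q != 0 -> (k <= m)%N ->
  q ^+ (m.-1 * k) * q^-1 ^+ ((k * (k - 1)) %/ 2) * q^-1 ^+ (k * (m - k)) =
  q ^+ ((k * (k - 1)) %/ 2).
Proof.
move=> q0 km; set b := ((k * (k - 1)) %/ 2)%N.
have b2 : (b + b = k * (k - 1))%N.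
  rewrite addnn -muln2 /b divnK // dvdn2.
  by case: (k) => // k'; rewrite subn1 oddM /= andNb.
have -> : (m.-1 * k = b + b + k * (m - k))%N.
  rewrite b2 -mulnDr mulnC; case: k km {b b2} => // k km; congr (_ * _)%N.
  by rewrite subn1 -[in LHS](subnKC km).
by rewrite !exprD !exprVn mulrAC mulfK ?mulfK ?expf_neq0.
Qed.

Theorem corollary3p3 (R : realType) (m n : nat) (hm : (0 < m)%N) (hn : (0 < n)%N)
    (q z : R[i]) (u : 'I_n -> R[i]) (v : 'I_m -> R[i])
    (hgen : general_position q z u v) :
  F_trig q z u v =
    (\prod_(i < m) \prod_(j < m | (i < j)%N) (v j - v i))^-1 *
    \det (\matrix_(i < m, j < m)
      (v j ^+ i - z * q ^+ (m - i.+1) * v j ^+ i *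
        \prod_(l < n) ((v j - u l) / (v j - q * u l))))
  /\
  G_trig q z u v =
    qpoch_ratio m n q z *
    (\prod_(i < n) \prod_(j < n | (i < j)%N) (u j - u i))^-1 *
    \det (\matrix_(i < n, j < n)
      (u j ^+ i - z * q ^ (m%:Z - n%:Z + i%:Z) * u j ^+ i *
        \prod_(l < m) ((v l - u j) / (v l - q * u j)))).
Proof.
case: hgen => q0 u_inj v_inj _ _; split.
- have -> : \matrix_(i < m, j < m) (v j ^+ i - z * q ^+ (m - i.+1) * v j ^+ i *
      \prod_(l < n) ((v j - u l) / (v j - q * u l))) =
    \matrix_(i < m, j < m) (v j ^+ i +
      (- z * q ^+ m.-1 * \prod_(l < n) ((v j - u l) / (v j - q * u l))) *
      (q^-1 * v j) ^+ i).
    apply/matrixP => i j; rewrite !mxE !mulNr; congr (_ - _).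
    have -> : q ^+ m.-1 = q ^+ (m - i.+1) * q ^+ i.
      by rewrite -exprD -[X in X.-1](subnK (ltn_ord i)) addnS.
    rewrite exprMn exprVn [RHS]mulrAC; congr (_ * _).
    by rewrite -!mulrA mulVKf ?expf_neq0.
  rewrite det_vandermonde_perturb // /F_trig; apply: eq_bigr => K _.
  have -> : \prod_(i in K) \prod_(j | j \notin K)
        ((q^-1 * v i - v j) / (v i - v j)) =
      q^-1 ^+ (#|K| * (m - #|K|)) *
      \prod_(i in K) \prod_(j | j \notin K) ((v i - q * v j) / (v i - v j)).
    (* each of the [#|K| * (m - #|K|)] mixed pairs gives up one [q^-1] *)
    have cK : #|[predC K]| = (m - #|K|)%N.
      by have := cardC (mem K); rewrite card_ord => /(canRL (addKn _)).
    rewrite mulnC exprM -prodr_const -big_split; apply: eq_bigr => i _ /=.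
    rewrite -cK -prodr_const -big_split; apply: eq_bigr => j _ /=.
    by rewrite mulrA mulrBr mulKf.
  have Km : (#|K| <= m)%N by have := max_card (mem K); rewrite card_ord.
  rewrite big_split /= prodr_const exprMn -exprM -(expf_mixed_pairs q0 Km).
  rewrite -!mulrA; congr (_ * (_ * _)).
  by rewrite [RHS]mulrC -!mulrA.
- rewrite /G_trig -mulrA; congr (_ * _).
  have -> : \matrix_(i < n, j < n) (u j ^+ i -
      z * q ^ (m%:Z - n%:Z + i%:Z) * u j ^+ i *
      \prod_(l < m) ((v l - u j) / (v l - q * u j))) =
    \matrix_(i < n, j < n) (u j ^+ i +
      (- (q ^ (m%:Z - n%:Z) * z) *
        \prod_(l < m) ((v l - u j) / (v l - q * u j))) * (q * u j) ^+ i).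
    apply/matrixP => i j; rewrite !mxE !mulNr; congr (_ - _).
    rewrite expfzDr // -exprnP exprMn [RHS]mulrAC; congr (_ * _).
    by rewrite !mulrA [z * _]mulrC.
  rewrite det_vandermonde_perturb //; apply: eq_bigr => K _.
  rewrite big_split /= prodr_const [LHS]mulrAC; congr (_ * _).
  by rewrite mulrAC.
Qed.
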